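(* Consider the LQG setting of the context with a single input ($m=1$). Let $D_1,\dots,D_N$ be the expert trajectories, of length $T\ge n(l+2)-1$, from $N$ source LQG tasks with weight matrices $\{Q_i,R_i\}_{i=1}^N$ for the same system and noise statistics. Let $K^i_{\rm LQG}=K^iL_{\rm est}$ be the LQG gain of the $i$-th source task, where $K^i=\begin{bmatrix}K^i_{\rm LQR}&I_m\end{bmatrix}$ and $K^i_{\rm LQR}$ is the LQR gain of that task, and assume $$\bigcap_{i=1}^N\operatorname{Ker}(K^i)=\{0\}.$$ Then $$\operatorname{Ker}(L_{\rm est})=\bigcap_{i=1}^N\operatorname{Ker}\!\left(\bar U^i_{c_s}\,(H^i_{n,c_s})^\dagger\right),$$ where $\bar U^i_{c_s}$ and $H^i_{n,c_s}$ are the data matrices of the context constructed from $D_i$, with $c_s=T-n+1$.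
   Context: System: $x(t+1)=Ax(t)+Bu(t)+w(t)$, $y(t)=Cx(t)+v(t)$, $t\ge0$, with $x(t)\in\mathbb R^n$, $u(t)\in\mathbb R^m$, $y(t)\in\mathbb R^l$; the process and measurement noise sequences are independent at all times, with $w(t)\sim\mathcal N(0,W)$, $v(t)\sim\mathcal N(0,V)$, $W\succeq0$, $V\succ0$. $(A,B)$ and $(A,W^{1/2})$ are controllable, $(A,C)$ is observable. An LQG task with weights $Q\succeq0$, $R\succ0$, $(A,Q^{1/2})$ observable, asks to minimize $\lim_{T\to\infty}\mathbb E[\frac1T\sum_{t=0}^{T-1}(x(t)^{\mathsf T}Qx(t)+u(t)^{\mathsf T}Ru(t))]$. LQG controller of a task: $\hat x(t+1)=E\hat x(t)+Fu(t)+Gy(t+1)$, $u(t)=H\hat x(t)$, with $E=(I-L_{\rm f}C)A$, $F=(I-L_{\rm f}C)B$, $G=L_{\rm f}$, $H=K_{\rm LQR}$, where $K_{\rm LQR}\in\mathbb R^{m\times n}$ is the LQR gain for the weights of the task (with the sign convention that the optimal input is $u=K_{\rm LQR}\hat x$) and $L_{\rm f}\in\mathbb R^{n\times l}$ is the (steady-state) Kalman gain of the system. Only $K_{\rm LQR}$ depends on the task. Standing assumption (for each task): for every $i\in\{1,\dots,m\}$ the pair $(E,K_{{\rm LQR},i})$ is observable, where $K_{{\rm LQR},i}$ is the $i$-th row of $K_{\rm LQR}$, and the pair $(E,L_{\rm f})$ is controllable. Estimation matrix (common to all tasks): with $a=[a_0\ \cdots\ a_{n-1}]$ such that $E^n=a_0I+a_1E+\cdots+a_{n-1}E^{n-1}$,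 $$L_{\rm est}=\begin{bmatrix}F_u-(a\otimes I_n)\tilde M_u & F_y-(a\otimes I_n)\tilde M_y\\ a\otimes I_m&0\end{bmatrix},$$ $F_u=[E^{n-1}F\ \cdots\ EF\ F]$, $F_y=[E^{n-1}G\ \cdots\ EG\ G]$, and $\tilde M_u$ (resp. $\tilde M_y$) the $n\times n$ block matrix with $(i,j)$ block $E^{i-j-1}F$ (resp. $E^{i-j-1}G$) for $i>j$ and $0$ otherwise. $\otimes$ is the Kronecker product and $\dagger$ the Moore–Penrose pseudoinverse. Data matrices: the expert data $D_i=\{u_i^*,y_i^*\}_t^{t+T}$ are the optimal LQG inputs for the weights $Q_i,R_i$ and the corresponding outputs of the system, from time $t$ to $t+T$. With $U_n^i(s)=[u_i^*(s)^{\mathsf T},\dots,u_i^*(s+n-1)^{\mathsf T}]^{\mathsf T}$ and $Y_n^i(s)=[y_i^*(s)^{\mathsf T},\dots,y_i^*(s+n-1)^{\mathsf T}]^{\mathsf T}$, $$H^i_{n,c}=\begin{bmatrix}U^i_n(t)&\cdots&U^i_n(t+c-1)\\ Y^i_n(t+1)&\cdots&Y^i_n(t+c)\end{bmatrix},\qquad \bar U^i_c=\begin{bmatrix}u_i^*(t+n)&\cdots&u_i^*(t+n+c-1)\end{bmatrix}.$$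
   Formalization: The identity is claimed almost surely, and it is assumed that for each task and each fixed nonzero row vector p, almost surely p x̂(s) ≠ 0 for some s in [t,t+T]; without this it can fail, e.g. for x̂(0)=0 when (E+FK_LQR, L_f) is not controllable. *)

(* Defs.v *)
From HB Require Import structures.
From mathcomp Require Import all_boot all_order all_algebra.
From mathcomp Require Import all_classical all_reals all_analysis.

Set Implicit Arguments.
Unset Strict Implicit.
Unset Printing Implicit Defensive.

Import Order.TTheory GRing.Theory Num.Theory.
Import numFieldNormedType.Exports.

Local Open Scope classical_set_scope.
Local Open Scope ring_scope.

Definition Ker (R : realType) p q (M : 'M[R]_(p, q)) : set 'cV[R]_q :=
  [set z | M *m z = 0].

Definition psd (R : realType) n (M : 'M[R]_n) : Prop :=
  M^T = M /\ forall z : 'cV[R]_n, 0 <= (z^T *m M *m z) 0 0.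

Definition posdef (R : realType) n (M : 'M[R]_n) : Prop :=
  M^T = M /\ forall z : 'cV[R]_n, z != 0 -> 0 < (z^T *m M *m z) 0 0.

(* S = M^{1/2} *)
Definition is_psd_sqrt (R : realType) n (M S : 'M[R]_n) : Prop :=
  psd S /\ S *m S = M.

Definition controllable (R : realType) n m (A : 'M[R]_n) (B : 'M[R]_(n, m)) :
    Prop :=
  \rank (\mxrow_(k < n) (A ^+ k *m B)) = n.

Definition observable (R : realType) n l (A : 'M[R]_n) (C : 'M[R]_(l, n)) :
    Prop :=
  \rank (\mxcol_(k < n) (C *m A ^+ k)) = n.

Definition is_mpinv (R : realType) p q (M : 'M[R]_(p, q)) (X : 'M[R]_(q, p)) :
    Prop :=
  [/\ M *m X *m M = M, X *m M *m X = X,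
      (M *m X)^T = M *m X & (X *m M)^T = X *m M].

Definition mpinv (R : realType) p q (M : 'M[R]_(p, q)) : 'M[R]_(q, p) :=
  xget 0 [set X | is_mpinv M X].

Lemma gram_unit (R : realType) r q (M : 'M[R]_(r, q)) :
  row_free M -> M *m M^T \in unitmx.
Proof.
move=> fM; rewrite -row_free_unit -kermx_eq0; apply/rowV0P => z /sub_kermxP zMM.
have s0 : \sum_j (z *m M) 0 j ^+ 2 = 0.
  transitivity (((z *m M) *m (z *m M)^T) 0 0).
    by rewrite [RHS]mxE; apply: eq_bigr => j _; rewrite [_^T _ _]mxE expr2.
  by rewrite trmx_mul mulmxA -(mulmxA z) zMM mul0mx mxE.
have zM0 : z *m M = 0.
  apply/rowP => j; rewrite [RHS]mxE; apply/eqP; rewrite -sqrf_eq0; apply/eqP.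
  exact: (psumr_eq0P (fun k _ => sqr_ge0 _) s0).
by apply: (row_free_inj fM); rewrite zM0 mul0mx.
Qed.

Lemma is_mpinv_uniq (R : realType) p q (M : 'M[R]_(p, q)) (X Y : 'M[R]_(q, p)) :
  is_mpinv M X -> is_mpinv M Y -> X = Y.
Proof.
move=> [mx xm tmx txm] [my ym tmy tym].
have e1 : M *m X = M *m Y.
  rewrite -{1}my -[LHS]trmxK -(mulmxA (M *m Y)) trmx_mul tmx tmy.
  by rewrite mulmxA mx.
have e2 : X *m M = Y *m M.
  rewrite -{1}my -[LHS]trmxK (mulmxA X) (mulmxA X M Y) -mulmxA.
  by rewrite trmx_mul txm tym -mulmxA (mulmxA M) mx.
by rewrite -xm e2 -mulmxA e1 mulmxA ym.
Qed.

Lemma is_mpinv_full_rank (R : realType) p r q (L : 'M[R]_(p, r))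
    (U : 'M[R]_(r, q)) : row_free L^T -> row_free U ->
  is_mpinv (L *m U)
    (U^T *m invmx (U *m U^T) *m (invmx (L^T *m L) *m L^T)).
Proof.
move=> fL fU; have uU := gram_unit fU.
have uL : L^T *m L \in unitmx by rewrite -[X in _ *m X]trmxK gram_unit.
set X := _ *m (_ *m L^T).
have MX : L *m U *m X = L *m invmx (L^T *m L) *m L^T.
  rewrite /X !mulmxA -(mulmxA L U) -(mulmxA L (U *m U^T)).
  by rewrite mulmxV // mulmx1.
have XM : X *m (L *m U) = U^T *m invmx (U *m U^T) *m U.
  rewrite /X !mulmxA -(mulmxA _ L^T L) -(mulmxA _ _ (L^T *m L)).
  by rewrite mulVmx // mulmx1.
split.
- by rewrite MX -!mulmxA (mulmxA L^T) (mulmxA _ (L^T *m L)) mulVmx // mul1mx.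
- rewrite XM /X !mulmxA -(mulmxA _ U U^T) -(mulmxA _ _ (U *m U^T)).
  by rewrite mulVmx // mulmx1.
- by rewrite MX !trmx_mul trmxK trmx_inv trmx_mul trmxK mulmxA.
- by rewrite XM !trmx_mul trmxK trmx_inv trmx_mul trmxK mulmxA.
Qed.

Lemma mpinvP (R : realType) p q (M : 'M[R]_(p, q)) : is_mpinv M (mpinv M).
Proof.
suff [X MX] : exists X, is_mpinv M X.
  by apply: (@xgetPex _ 0 [set X | is_mpinv M X]); exists X.
rewrite -[M in is_mpinv M]mulmx_base.
eexists; apply: is_mpinv_full_rank; last exact: row_base_free.
by rewrite /row_free mxrank_tr; apply: col_base_full.
Qed.

Section Riccati.
Context {R : realType}.

Definition is_dare_solution n m (A : 'M[R]_n) (B : 'M[R]_(n, m)) (Q : 'M[R]_n)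
    (Rw : 'M[R]_m) (S : 'M[R]_n) : Prop :=
  psd S /\
  S = A^T *m S *m A
      - A^T *m S *m B *m invmx (Rw + B^T *m S *m B) *m B^T *m S *m A + Q.

(* The sign is that of the optimal input u = K x. *)
Definition is_lqr_gain n m (A : 'M[R]_n) (B : 'M[R]_(n, m)) (Q : 'M[R]_n)
    (Rw : 'M[R]_m) (K : 'M[R]_(m, n)) : Prop :=
  exists2 S, is_dare_solution A B Q Rw S
    & K = - (invmx (Rw + B^T *m S *m B) *m B^T *m S *m A).

(* P is the steady-state one-step-ahead prediction error covariance; the gain
   is the measurement-update gain, as E = (I - L C) A requires. *)
Definition is_kalman_gain n l (A : 'M[R]_n) (C : 'M[R]_(l, n)) (W : 'M[R]_n)
    (V : 'M[R]_l) (L : 'M[R]_(n, l)) : Prop :=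
  exists2 P, is_dare_solution A^T C^T W V P
    & L = P *m C^T *m invmx (V + C *m P *m C^T).

Definition ctrlE n l (A : 'M[R]_n) (C : 'M[R]_(l, n)) (L : 'M[R]_(n, l)) :
  'M[R]_n := (1%:M - L *m C) *m A.

Definition ctrlF n m l (B : 'M[R]_(n, m)) (C : 'M[R]_(l, n))
  (L : 'M[R]_(n, l)) : 'M[R]_(n, m) := (1%:M - L *m C) *m B.

End Riccati.

Section EstimationMatrix.
Context {R : realType}.

(* [E^{n-1}G ... E G G] *)
Definition estF n q (E : 'M[R]_n) (G : 'M[R]_(n, q)) :
    'M[R]_(n, \sum_(j < n) q) :=
  \mxrow_(j < n) (E ^+ (n - 1 - j) *m G).

Definition estM n q (E : 'M[R]_n) (G : 'M[R]_(n, q)) :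
    'M[R]_(\sum_(i < n) n, \sum_(j < n) q) :=
  \mxblock_(i < n, j < n) (if (j < i)%N then E ^+ (i - j - 1) *m G else 0).

(* a (x) I_k = [a_0 I_k ... a_{n-1} I_k], written on the column type of the
   library's block matrices. *)
Definition kron_id n (a : 'rV[R]_n) k : 'M[R]_(k, \sum_(j < n) k) :=
  \mxrow_(j < n) ((a 0 j)%:M : 'M[R]_k).

Definition Lest n m l (E : 'M[R]_n) (F : 'M[R]_(n, m)) (G : 'M[R]_(n, l))
    (a : 'rV[R]_n) : 'M[R]_(n + m, \sum_(j < n) m + \sum_(j < n) l) :=
  block_mx (estF E F - kron_id a n *m estM E F)
           (estF E G - kron_id a n *m estM E G)
           (kron_id a m) 0.

End EstimationMatrix.

Section DataMatrices.
Context {R : realType}.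

(* [z(s)^T, ..., z(s+n-1)^T]^T *)
Definition stack q n (z : nat -> 'cV[R]_q) (s : nat) :
    'cV[R]_(\sum_(k < n) q) :=
  \mxcol_(k < n) z (s + k)%N.

Definition hcat q c (z : nat -> 'cV[R]_q) : 'M[R]_(q, c) :=
  \matrix_(i < q, j < c) z j i 0.

Definition dataH m l n c (u : nat -> 'cV[R]_m) (y : nat -> 'cV[R]_l)
    (t : nat) : 'M[R]_(\sum_(k < n) m + \sum_(k < n) l, c) :=
  col_mx (hcat c (fun j => stack n u (t + j)))
         (hcat c (fun j => stack n y (t + 1 + j))).

Definition dataU m n c (u : nat -> 'cV[R]_m) (t : nat) : 'M[R]_(m, c) :=
  hcat c (fun j => u (t + n + j)%N).

End DataMatrices.

Section Probability.
Context {R : realType} {d : measure_display} {Omega : measurableType d}.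
Variable P : probability Omega R.

Definition random_vector k (X : Omega -> 'cV[R]_k) : Prop :=
  forall i, measurable_fun setT (fun om => X om i 0).

(* N(0, s2) on R.  The library's normal_prob is not the Dirac mass when its
   standard deviation is 0, so that case is separate. *)
Definition centered_normal (s2 : R) : set (measurableTypeR R) -> \bar R :=
  fun D => if s2 == 0 then \d_(0 : R) D else normal_prob 0 (Num.sqrt s2) D.

(* X ~ N(0, Sigma), Sigma possibly singular: each b^T X is N(0, b^T Sigma b). *)
Definition gaussian k (X : Omega -> 'cV[R]_k) (Sigma : 'M[R]_k) : Prop :=
  random_vector X /\
  forall (b : 'cV[R]_k) (D : set (measurableTypeR R)), measurable D ->
    P [set om | D ((b^T *m X om) 0 0)]
    = centered_normal ((b^T *m Sigma *m b) 0 0) D.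

Definition sigma_of k (X : Omega -> 'cV[R]_k) : set (set Omega) :=
  <<s [set D' | exists (i : 'I_k) (D : set (measurableTypeR R)),
        measurable D /\ D' = [set om | D (X om i 0)]] >>.

Definition mutually_independent (J : choiceType) (F : J -> set (set Omega)) :
    Prop :=
  forall (s : seq J) (D : J -> set Omega), uniq s ->
    (forall j, j \in s -> F j (D j)) ->
    P (\bigcap_(j in [set` s]) D j) = (\prod_(j <- s) P (D j))%E.

(* Independent blocks of a run: (x(0), xh(0), v(0)), then each w(s) and each
   v(s+1).  The initial estimate may depend on y(0), hence on v(0). *)
Definition run_blocks n l (x0 xh0 : Omega -> 'cV[R]_n)
    (w : nat -> Omega -> 'cV[R]_n) (v : nat -> Omega -> 'cV[R]_l)
    (j : option (nat + nat)) : set (set Omega) :=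
  match j with
  | None => sigma_of (fun om => col_mx (x0 om) (col_mx (xh0 om) (v 0%N om)))
  | Some (inl s) => sigma_of (w s)
  | Some (inr s) => sigma_of (v s.+1)
  end.

(* A trajectory of the system in closed loop with the LQG controller of gains
   K and L; x(0) and xh(0) have arbitrary laws. *)
Record lqg_run n m l (A : 'M[R]_n) (B : 'M[R]_(n, m)) (C : 'M[R]_(l, n))
    (W : 'M[R]_n) (V : 'M[R]_l) (K : 'M[R]_(m, n)) (L : 'M[R]_(n, l))
    (w : nat -> Omega -> 'cV[R]_n) (v : nat -> Omega -> 'cV[R]_l)
    (x xh : nat -> Omega -> 'cV[R]_n) (u : nat -> Omega -> 'cV[R]_m)
    (y : nat -> Omega -> 'cV[R]_l) : Prop := LqgRun {
  run_w : forall s, gaussian (w s) W;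
  run_v : forall s, gaussian (v s) V;
  run_x0 : random_vector (x 0%N);
  run_xh0 : random_vector (xh 0%N);
  run_indep : mutually_independent (run_blocks (x 0%N) (xh 0%N) w v);
  run_x : forall s om, x s.+1 om = A *m x s om + B *m u s om + w s om;
  run_y : forall s om, y s om = C *m x s om + v s om;
  run_xh : forall s om,
    xh s.+1 om = ctrlE A C L *m xh s om + ctrlF B C L *m u s om
                 + L *m y s.+1 om;
  run_u : forall s om, u s om = K *m xh s om
}.

(* The controller state is not confined to a fixed hyperplane during
   [t, t + T].  For a run with V > 0 and T >= n this is automatic when
   (E + F K, L) is controllable, and also when xh(t) has a density, but it does
   not follow from controllability of (E, L) (take xh(0) = 0): if it fails, a
   fixed nonzero combination of the rows of dataH vanishes with positive
   probability. *)
Definition not_confined n (xh : nat -> Omega -> 'cV[R]_n) (t T : nat) : Prop :=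
  forall p : 'rV[R]_n, p != 0 ->
    {ae P, forall om, exists2 s, (t <= s <= t + T)%N & p *m xh s om != 0}.

End Probability.

(* Main.v *)
(* Write Phi = E + F K, so that xh(s+1) = Phi xh(s) + L y(s+1).  Eliminating
   E^n with the relation defining a gives u(s+n) = K Lest (U_n(s); Y_n(s+1)) for
   every s; hence, as soon as the data matrix H has full row rank,
   dataU H^+ = [K I] Lest, and the kernels of these gains intersect in Ker Lest
   because the Ker [K_i I] intersect in 0.

   Full row rank holds almost surely.  As (Phi, K) is observable with a single
   output, u(s), ..., u(s+n-1) can be traded for xh(s), so the columns to consider are
   (xh(s); y(s+1); ...; y(s+n)).  Such a column is a free response plus a sum of
   fixed gains applied to past outputs.  Let N be the left annihilator of the
   columns seen so far, and take the most recent output whose gain N does not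
   kill: N is determined without that output, whose measurement noise is
   independent of everything else and has a density, so the next column almost
   surely cuts the dimension of N.  If N kills all the gains, it contains some
   (p, 0) with p orthogonal to the reachable space of (Phi, L) and to
   xh(t), xh(t+1), ...; since (Phi, K) is observable with one output, such a p
   would generate one of finitely many Phi-invariant spaces of row vectors, and
   not_confined excludes each of them. *)

Require Import Defs.
From HB Require Import structures.
From mathcomp Require Import all_boot all_order all_algebra.
From mathcomp Require Import all_classical all_reals all_analysis.
From mathcomp Require Import measurable_realfun.
From mathcomp Require Import zify.

Set Implicit Arguments.
Unset Strict Implicit.
Unset Printing Implicit Defensive.

Import Order.TTheory GRing.Theory Num.Theory.
Import numFieldNormedType.Exports.

Local Open Scope classical_set_scope.
Local Open Scope ring_scope.

(** * Independence and Gaussian noise *)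

Section Independence.
Context {R : realType} {d : measure_display} {Omega : measurableType d}.
Variable P : probability Omega R.

Lemma mutually_independent_rest (J : choiceType) (F : J -> set (set Omega))
    (j0 : J) (G H : set Omega) :
  mutually_independent P F -> (forall j, F j `<=` measurable) ->
  (forall j, F j setT) -> (forall j, setI_closed (F j)) ->
  <<s \bigcup_(j in [set~ j0]) F j >> G -> F j0 H ->
  P (G `&` H) = (P G * P H)%E.
Proof.
move=> indep Fm FT FI sG FH.
have mH := Fm _ _ FH.
pose Cyl := [set X | exists (s : seq J) (D : J -> set Omega),
  [/\ uniq s, j0 \notin s, forall j, j \in s -> F j (D j) &
      X = \bigcap_(j in [set` s]) D j]].
have CylI : setI_closed Cyl.
  move=> _ _ [s [D [us js FD ->]]] [s' [D' [us' js' FD' ->]]].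
  exists (undup (s ++ s')), (fun j => (if j \in s then D j else setT) `&`
      (if j \in s' then D' j else setT)); split.
  - exact: undup_uniq.
  - by rewrite mem_undup mem_cat negb_or js.
  - by move=> j _; apply: FI; case: ifP => // jj; [exact: FD|exact: FD'].
  - apply/seteqP; split=> [om [DD DD'] j /= _|om DD]; last split=> j /= js2.
    + by split; case: ifP => // jj; [apply: DD|apply: DD'].
    + by have /= := DD j; rewrite mem_undup mem_cat js2 => /(_ isT)[].
    + by have /= := DD j; rewrite mem_undup mem_cat js2 orbT => /(_ isT)[].
have CylT : Cyl setT.
  exists [::], (fun=> setT); split=> //.
  by apply/seteqP; split.
have Cylm : Cyl `<=` measurable.
  move=> _ [s [D [_ _ FD ->]]]; apply: fin_bigcap_measurable.
    exact: finite_seq.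
  by move=> j /= /FD /Fm.
have p0 : (0 <= fine (P H))%R by exact: fine_ge0.
have -> : P (G `&` H) = mrestr P mH G by [].
have scaleE X : mscale (NngNum p0) P X = (P H * P X)%E.
  rewrite /mscale; congr (_ * _)%E.
  by rewrite -[RHS]fineK ?fin_num_measure.
rewrite muleC -scaleE.
have sub : <<s \bigcup_(j in [set~ j0]) F j >> `<=` <<s Cyl >>.
  apply: sub_sigma_algebra2 => X [j /= jj0 FX].
  exists [:: j], (fun=> X); split=> //.
  - by rewrite inE eq_sym; apply/eqP.
  - by move=> k; rewrite inE => /eqP ->.
  - apply/seteqP; split=> [om Xom k //|om /(_ j)]; apply.
    by rewrite /= inE.
apply: (g_sigma_algebra_measure_unique Cyl Cylm (fun=> setT)) => //.
- by rewrite bigcup_const//; exists 0%N.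
- move=> _ [s [D [us js FD ->]]].
  rewrite -[RHS]/(mscale (NngNum p0) P _) scaleE -[LHS]/(P (_ `&` H)).
  have := indep (j0 :: s) (fun j => if j == j0 then H else D j).
  rewrite /= us js big_cons eqxx => /(_ isT) indep0.
  have Ejs j : j \in s -> (j == j0) = false.
    by move=> jins; apply/eqP => E; rewrite -E jins in js.
  rewrite (_ : _ `&` H =
      \bigcap_(j in [set` j0 :: s]) (if j == j0 then H else D j)); last first.
    apply/seteqP; split=> [om [DD Hom] j /=|om DD].
      by rewrite inE; case: eqP => //= _ jins; exact: DD.
    split=> [j /= jins|].
      by have /= := DD j; rewrite inE jins orbT Ejs// => /(_ isT).
    by have /= := DD j0; rewrite inE eqxx => /(_ isT).
  rewrite indep0; last first.
    by move=> j; rewrite inE; case: eqP => [->//|_ /=]; exact: FD.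
  congr (_ * _)%E; rewrite indep//.
  by rewrite !big_seq; apply: eq_bigr => j jins; rewrite Ejs.
- move=> _; rewrite -[X in (X < _)%E]/(P (setT `&` H)) setTI.
  by rewrite (le_lt_trans (probability_le1 P mH))// ltry.
- exact: sub.
Qed.

End Independence.

Section Freshness.
Context {R : realType} {d : measure_display} {Omega : measurableType d}.
Variable P : probability Omega R.

Lemma sigma_sub_measurable (GG : set (set Omega)) :
  GG `<=` measurable -> <<s GG >> `<=` measurable.
Proof.
by move=> GGm; apply: smallest_sub GGm; exact: sigma_algebra_measurable.
Qed.

Lemma measurable_fun_sub_sigma (GG : set (set Omega)) :
  GG `<=` measurable ->
  measurable_fun setT (fun om : Omega => om : g_sigma_algebraType GG).
Proof.
by move=> GGm _ A mA; rewrite setTI; exact: (sigma_sub_measurable GGm mA).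
Qed.

(* By independence, om |-> (om, om) pushes P to the product of its restrictions
   to the two sigma-algebras, so Tonelli applies on Omega * Omega. *)
Lemma diagonal_negligible (GG HH : set (set Omega))
    (S : set (g_sigma_algebraType GG * g_sigma_algebraType HH)) :
  GG `<=` measurable -> HH `<=` measurable ->
  (forall G H, <<s GG >> G -> <<s HH >> H -> P (G `&` H) = (P G * P H)%E) ->
  measurable S -> (forall om, P (xsection S om) = 0) ->
  P.-negligible [set om | S (om, om)].
Proof.
move=> GGm HHm indep mS S0.
have mG := measurable_fun_sub_sigma GGm.
have mH := measurable_fun_sub_sigma HHm.
have mD := measurable_fun_pair mG mH.
pose PG := distribution P (mfun_Sub (mem_set mG)).
pose PH := distribution P (mfun_Sub (mem_set mH)).
pose PD := distribution P (mfun_Sub (mem_set mD)).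
have PDE : (PG \x PH)%E S = PD S.
  apply: product_measure_unique => [A B mA mB|]; last exact: mS.
  by rewrite -[LHS]/(P (A `&` B)) (indep _ _ mA mB).
apply/negligibleP.
  by have := mD measurableT _ mS; rewrite setTI.
rewrite -[LHS]/(PD S) -PDE /product_measure1 integral0_eq// => om _.
exact: S0.
Qed.

Lemma posdef_form_gt0 k (V : 'M[R]_k) (q : 'rV[R]_k) :
  posdef V -> q != 0 -> 0 < (q *m V *m q^T) 0 0.
Proof.
move=> [_ posV] q0; have := posV q^T; rewrite trmxK; apply.
by rewrite -trmx0 (inj_eq trmx_inj).
Qed.

Lemma gaussian_level_null k (X : Omega -> 'cV[R]_k) (V : 'M[R]_k)
    (q : 'rV[R]_k) (r : R) : posdef V -> gaussian P X V -> q != 0 ->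
  P [set om | (q *m X om) 0 0 = r] = 0.
Proof.
move=> posV [_ gX] q0; have := gX q^T [set r] (measurable_set1 r).
rewrite trmxK => ->; rewrite /centered_normal gt_eqF ?posdef_form_gt0//.
have /null_content_dominatesP dom :=
  normal_prob_dominates 0 (Num.sqrt ((q *m V *m q^T) 0 0)).
by apply: dom => //; exact: lebesgue_measure_set1.
Qed.

Lemma gaussian_fresh k (GG : set (set Omega)) (X : Omega -> 'cV[R]_k)
    (V : 'M[R]_k) (q : g_sigma_algebraType GG -> 'rV[R]_k)
    (c : g_sigma_algebraType GG -> R) :
  posdef V -> gaussian P X V -> GG `<=` measurable ->
  (forall G H, <<s GG >> G -> sigma_of X H -> P (G `&` H) = (P G * P H)%E) ->
  (forall j, measurable_fun setT (fun om => q om 0 j)) ->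
  measurable_fun setT c ->
  {ae P, forall om, q om != 0 -> (q om *m X om) 0 0 + c om != 0}.
Proof.
move=> posV gX GGm indep mq mc.
pose HH := [set D' | exists (i : 'I_k) (D : set (measurableTypeR R)),
        measurable D /\ D' = [set om | D (X om i 0)]].
have HHm : HH `<=` measurable.
  by move=> _ [i [D [mD ->]]]; rewrite -[X in measurable X]setTI; exact: gX.1.
have mX i : measurable_fun setT (fun om : g_sigma_algebraType HH => X om i 0).
  by move=> _ D mD; rewrite setTI; apply: sub_sigma_algebra; exists i, D.
pose S : set (g_sigma_algebraType GG * g_sigma_algebraType HH) :=
  [set z | q z.1 != 0 /\ (q z.1 *m X z.2) 0 0 + c z.1 = 0].
pose f (z : g_sigma_algebraType GG * g_sigma_algebraType HH) : R :=
  \sum_j q z.1 0 j * q z.1 0 j.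
pose g (z : g_sigma_algebraType GG * g_sigma_algebraType HH) : R :=
  \sum_j q z.1 0 j * X z.2 j 0 + c z.1.
have mf : measurable_fun setT f.
  have mq1 j := measurableT_comp (mq j) measurable_fst.
  by apply: measurable_sum => j; apply: measurable_funM; exact: mq1.
have mg : measurable_fun setT g.
  apply: measurable_funD; last exact: measurableT_comp mc measurable_fst.
  apply: measurable_sum => j; apply: measurable_funM.
    exact: measurableT_comp (mq j) measurable_fst.
  exact: measurableT_comp (mX j) measurable_snd.
have mS : measurable S.
  rewrite (_ : S = (~` (f @^-1` [set 0])) `&` (g @^-1` [set 0])).
    apply: measurableI.
      apply: measurableC; rewrite -[X in measurable X]setTI.
      exact: mf measurableT _ (measurable_set1 _).
    rewrite -[X in measurable X]setTI.
    exact: mg measurableT _ (measurable_set1 _).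
  apply/seteqP; split=> z /=; rewrite /f /g.
    move=> [q0 E]; split; last by move: E; rewrite mxE.
    move=> s0; case/eqP: q0; apply/rowP => j; rewrite [RHS]mxE.
    apply/eqP; rewrite -sqrf_eq0; apply/eqP.
    by rewrite expr2; exact: (psumr_eq0P (fun k _ => sqr_ge0 _) s0).
  move=> [f0 E]; split; last by rewrite mxE.
  apply/eqP => q0; apply: f0; rewrite q0 big1// => j _.
  by rewrite mxE mul0r.
have /negligibleS : P.-negligible [set om | S (om, om)].
  apply: (diagonal_negligible GGm HHm) => // om.
  have [q0|q0] := eqVneq (q om) 0.
    rewrite (_ : xsection S om = set0) ?measure0//.
    apply/seteqP; split=> // om'.
    by rewrite /xsection /= inE /S /= q0 eqxx => -[].
  rewrite -[RHS](gaussian_level_null (- c om) posV gX q0); congr (P _).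
  apply/seteqP; split=> om'; rewrite /xsection /= inE /S /=.
    by move=> [_ /eqP]; rewrite addr_eq0 => /eqP.
  by move=> ->; rewrite addNr.
apply => om /= /not_implyP[q0 /negP]; rewrite negbK => /eqP E.
by [].
Qed.

End Freshness.

(** * Left annihilators of random columns *)

Section Annihilator.
Context {R : realType}.

Lemma normsq_eq0 k (e : 'cV[R]_k) : ((e^T *m e) 0 0 == 0) = (e == 0).
Proof.
apply/eqP/eqP => [|->]; last by rewrite mulmx0 mxE.
rewrite mxE => s0; have {}s0 : \sum_i e i 0 ^+ 2 = 0.
  by rewrite -[RHS]s0; apply: eq_bigr => i _; rewrite mxE expr2.
apply/colP => i; rewrite [RHS]mxE; apply/eqP; rewrite -sqrf_eq0; apply/eqP.
exact: (psumr_eq0P (fun j _ => sqr_ge0 _) s0).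
Qed.

(* The rows of annul N c span the vectors p of the row space of N with p c = 0.
   Being a formula in the entries of N and c, it depends measurably on them. *)
Definition annul r (N : 'M[R]_r) (c : 'cV[R]_r) : 'M[R]_r :=
  let e := N *m c in
  ((e^T *m e) 0 0 + ((e^T *m e) 0 0 == 0)%:R) *: N - e *m (e^T *m N).

Lemma annul_weight_neq0 (s : R) : s + (s == 0)%:R != 0.
Proof. by have [->|s0] := eqVneq s 0; rewrite ?add0r ?oner_eq0 ?addr0. Qed.

Lemma annul_mulmx r (N : 'M[R]_r) (c : 'cV[R]_r) : annul N c *m c = 0.
Proof.
rewrite /annul; set e := N *m c.
rewrite mulmxBl -scalemxAl -!(mulmxA e) -(mulmxA _ N c) -/e.
have [e0|e0] := eqVneq e 0; first by rewrite e0 scaler0 mul0mx subr0.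
rewrite normsq_eq0 (negbTE e0) addr0.
have -> : e *m (e^T *m e) = (e^T *m e) 0 0 *: e; last by rewrite subrr.
by rewrite {1}[e^T *m e]mx11_scalar mul_mx_scalar.
Qed.

Lemma annul_sub r (N : 'M[R]_r) (c : 'cV[R]_r) : (annul N c <= N)%MS.
Proof.
apply: addmx_sub; first exact: scalemx_sub.
by rewrite eqmx_opp mulmxA submxMl.
Qed.

Lemma sub_annul m r (p : 'M[R]_(m, r)) (N : 'M[R]_r) (c : 'cV[R]_r) :
  (p <= annul N c)%MS = (p <= N)%MS && (p *m c == 0).
Proof.
apply/idP/andP => [ple|[/submxP[z ->] /eqP zc0]].
  split; first exact: submx_trans ple (annul_sub N c).
  by have /submxP[z ->] := ple; rewrite -mulmxA annul_mulmx mulmx0.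
set s := ((N *m c)^T *m (N *m c)) 0 0.
have s0 := annul_weight_neq0 s.
apply/submxP; exists ((s + (s == 0)%:R)^-1 *: z).
rewrite /annul -/s mulmxBr -scalemxAl -scalemxAr scalerA mulVf// scale1r.
by rewrite -scalemxAl !mulmxA zc0 !mul0mx scaler0 subr0.
Qed.

Lemma rank_annul_ge r (N : 'M[R]_r) (c : 'cV[R]_r) :
  (\rank N <= (\rank (annul N c)).+1)%N.
Proof.
set e := N *m c; set s := (e^T *m e) 0 0.
have s0 := annul_weight_neq0 s.
have sub : (N <= annul N c + e^T *m N)%MS.
  have NE : N = (s + (s == 0)%:R)^-1 *: (annul N c + e *m (e^T *m N)).
    by rewrite /annul subrK scalerA mulVf// scale1r.
  rewrite {1}NE; apply: scalemx_sub; apply: addmx_sub; first exact: addsmxSl.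
  by apply: submx_trans (addsmxSr _ _); exact: submxMl.
apply: leq_trans (mxrankS sub) _; apply: leq_trans (mxrank_adds_leqif _ _) _.
by rewrite -[leqRHS]addn1 leq_add2l rank_leq_row.
Qed.

Lemma rank_annul_lt r (N : 'M[R]_r) (c : 'cV[R]_r) :
  N *m c != 0 -> (\rank (annul N c) < \rank N)%N.
Proof.
move=> Nc0; rewrite (ltn_leqif (mxrank_leqif_sup (annul_sub N c))).
by rewrite sub_annul submx_refl.
Qed.

Definition annihilator r (N : 'M[R]_r) (cs : seq 'cV[R]_r) : 'M[R]_r :=
  foldr (fun c M => annul M c) N cs.

Lemma sub_annihilator m r (p : 'M[R]_(m, r)) (N : 'M[R]_r) cs :
  (p <= annihilator N cs)%MS = (p <= N)%MS && all (fun c => p *m c == 0) cs.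
Proof.
elim: cs => [|c cs IH] /=; first by rewrite andbT.
by rewrite sub_annul IH -andbA [X in _ && X]andbC.
Qed.

End Annihilator.

Section MeasurableMatrices.
Context {R : realType} {d : measure_display} {T : measurableType d}.

Definition mx_measurable p q (M : T -> 'M[R]_(p, q)) : Prop :=
  forall i j, measurable_fun setT (fun om => M om i j).

Lemma mx_measurable_cst p q (M : 'M[R]_(p, q)) : mx_measurable (fun=> M).
Proof. by move=> i j; exact: measurable_cst. Qed.

Lemma mx_measurableD p q (M N : T -> 'M[R]_(p, q)) :
  mx_measurable M -> mx_measurable N -> mx_measurable (fun om => M om + N om).
Proof.
move=> mM mN i j; under eq_fun do rewrite mxE.
exact: measurable_funD (mM i j) (mN i j).
Qed.

Lemma mx_measurableM p q r (M : T -> 'M[R]_(p, q)) (N : T -> 'M[R]_(q, r)) :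
  mx_measurable M -> mx_measurable N -> mx_measurable (fun om => M om *m N om).
Proof.
move=> mM mN i j; under eq_fun do rewrite mxE.
by apply: measurable_sum => k; exact: measurable_funM (mM i k) (mN k j).
Qed.

Lemma mx_measurable_scale p q (s : T -> R) (M : T -> 'M[R]_(p, q)) :
  measurable_fun setT s -> mx_measurable M ->
  mx_measurable (fun om => s om *: M om).
Proof.
move=> ms mM i j; under eq_fun do rewrite mxE.
exact: measurable_funM ms (mM i j).
Qed.

Lemma mx_measurable_tr p q (M : T -> 'M[R]_(p, q)) :
  mx_measurable M -> mx_measurable (fun om => (M om)^T).
Proof. by move=> mM i j; under eq_fun do rewrite mxE; exact: mM. Qed.

Lemma mx_measurable_col_mx p1 p2 q (M : T -> 'M[R]_(p1, q))
    (N : T -> 'M[R]_(p2, q)) :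
  mx_measurable M -> mx_measurable N ->
  mx_measurable (fun om => col_mx (M om) (N om)).
Proof.
move=> mM mN i j; under eq_fun do rewrite mxE.
by case: (fintype.split i) => k; [exact: mM|exact: mN].
Qed.

Lemma mx_measurable_sum (I : Type) (s : seq I) (Pr : pred I) p q
    (M : I -> T -> 'M[R]_(p, q)) :
  (forall i, Pr i -> mx_measurable (M i)) ->
  mx_measurable (fun om => \sum_(i <- s | Pr i) M i om).
Proof.
move=> mM; elim: s => [|i s IH].
  by under eq_fun do rewrite big_nil; exact: mx_measurable_cst.
case Pi : (Pr i); under eq_fun do rewrite big_cons Pi; last exact: IH.
by apply: mx_measurableD => //; exact: mM.
Qed.

Lemma mx_measurable_annul r (N : T -> 'M[R]_r) (c : T -> 'cV[R]_r) :
  mx_measurable N -> mx_measurable c ->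
  mx_measurable (fun om => annul (N om) (c om)).
Proof.
move=> mN mc; have me := mx_measurableM mN mc.
have met := mx_measurable_tr me.
have ms := mx_measurableM met me 0 0.
apply: mx_measurableD.
  apply: mx_measurable_scale => //; apply: measurable_funD => //.
  have -> : (fun om => (((N om *m c om)^T *m (N om *m c om)) 0 0 == 0)%:R) =
    (fun om => if ((N om *m c om)^T *m (N om *m c om)) 0 0 == 0
               then 1 else 0 : R).
    by apply/funext => om; case: eqP.
  apply: measurable_fun_ifT => //; exact: measurable_fun_eqr.
under eq_fun do rewrite -scaleN1r; apply: mx_measurable_scale => //.
by apply: mx_measurableM => //; exact: mx_measurableM.
Qed.

Lemma mx_measurable_annihilator (I : eqType) r (N : T -> 'M[R]_r) (s : seq I)
    (c : I -> T -> 'cV[R]_r) :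
  mx_measurable N -> (forall i, i \in s -> mx_measurable (c i)) ->
  mx_measurable (fun om => annihilator (N om) [seq c i om | i <- s]).
Proof.
move=> mN; elim: s => [|i s IH] mc //=.
apply: mx_measurable_annul; last by apply: mc; rewrite mem_head.
by apply: IH => j js; apply: mc; rewrite inE js orbT.
Qed.

End MeasurableMatrices.

Section RankDrop.
Context {R : realType}.

Lemma rank_annihilator_ge r (N : 'M[R]_r) cs :
  (\rank N <= \rank (annihilator N cs) + size cs)%N.
Proof.
elim: cs => [|c cs IH] /=; first by rewrite addn0.
by rewrite addnS -addSn (leq_trans IH)// leq_add2r rank_annul_ge.
Qed.

Lemma sub_kermx_mxrow m r l k (p : 'M[R]_(m, r)) (Gam : 'I_k -> 'M[R]_(r, l)) :
  reflect (forall i, p *m Gam i = 0) (p <= kermx (\mxrow_(i < k) Gam i))%MS.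
Proof.
rewrite sub_kermx mul_mxrow; apply: (iffP eqP) => [E i|E].
  by rewrite -[LHS](mxrowK (fun i => p *m Gam i)) E submxrow0.
by rewrite (eq_mxrow _ (B_ := fun=> 0)) ?mxrow0.
Qed.

Variables (r l n : nat).
Variables (b : nat -> 'cV[R]_r) (Gam : nat -> 'M[R]_(r, l)).
Variable eta : nat -> 'cV[R]_l.

(* The part of the j-th column due to eta 0, ..., eta (e - 1): the shock eta i
   enters it through Gam (j + n - 1 - i). *)
Definition trunc (j e : nat) : 'cV[R]_r :=
  b j + \sum_(i < e | (i < j + n)%N) Gam (j + n - 1 - i) *m eta i.

Lemma truncS j e : (e < j + n)%N ->
  trunc j e.+1 = trunc j e + Gam (j + n - 1 - e) *m eta e.
Proof.
move=> ej; rewrite /trunc big_mkcond big_ord_recr /= -big_mkcond /= ej.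
by rewrite addrA.
Qed.

Definition fresh_kernel (j k : nat) : 'M[R]_r :=
  annihilator (kermx (\mxrow_(i < k) Gam i))
    [seq trunc i (j + n - 1 - k) | i <- iota 0 j].

Definition column_kernel (j : nat) : 'M[R]_r :=
  annihilator 1%:M [seq trunc i (i + n) | i <- iota 0 j].

Lemma trunc_split m (p : 'M[R]_(m, r)) j e :
  (forall i, (i < j + n - e)%N -> p *m Gam i = 0) ->
  p *m trunc j (j + n) = p *m trunc j e.
Proof.
move=> pG; rewrite !mulmxDr; congr (_ + _).
pose F i := Gam (j + n - 1 - i) *m eta i.
rewrite -!(big_mkord (fun i => (i < j + n)%N) F).
have [le|lt] := leqP e (j + n).
  rewrite (big_cat_nat (leq0n e) le)/= mulmxDr [X in _ + X]mulmx_sumr.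
  rewrite [X in _ + X]big1_seq ?addr0// => i /andP[_].
  rewrite mem_index_iota => /andP[ei ij]; rewrite mulmxA pG ?mul0mx//.
  by rewrite -subnDA ltn_sub2l// ?(leq_ltn_trans ei).
rewrite (big_cat_nat (leq0n (j + n)) (ltnW lt))/= [X in _ *m (_ + X)]big1_seq.
  by rewrite addr0.
by move=> i /andP[ij]; rewrite mem_index_iota leqNgt ij.
Qed.

Lemma column_kernelS j :
  (column_kernel j.+1 <= annul (column_kernel j) (trunc j (j + n)))%MS.
Proof.
have := submx_refl (column_kernel j.+1).
rewrite {2}/column_kernel sub_annihilator -addn1 iotaD map_cat all_cat /=.
rewrite andbT => /and3P[? ? ?].
rewrite sub_annul; apply/andP; split=> //.
by rewrite sub_annihilator; apply/andP.
Qed.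

Lemma sub_fresh_kernel m (p : 'M[R]_(m, r)) j k : (k < j + n)%N ->
  (p <= fresh_kernel j k)%MS =
  (p <= kermx (\mxrow_(i < k) Gam i))%MS && (p <= column_kernel j)%MS.
Proof.
move=> kj; rewrite !sub_annihilator submx1 /=.
have [/sub_kermx_mxrow pG|//] := boolP (p <= kermx _)%MS.
rewrite /= !all_map; apply: eq_in_all => i; rewrite mem_iota /= => ij.
rewrite -(@trunc_split _ p i (j + n - 1 - k))// => i' i'lt.
have i'k : (i' < k)%N by lia.
exact: (pG (Ordinal i'k)).
Qed.

Lemma column_kernel_eq0 :
  (forall j k, (j < r)%N -> (k < j + n)%N ->
    fresh_kernel j k *m Gam k != 0 ->
    fresh_kernel j k *m trunc j (j + n - k) != 0) ->
  (forall j, (j < r)%N -> column_kernel j != 0 ->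
    exists2 k, (k < j + n)%N & column_kernel j *m Gam k != 0) ->
  column_kernel r = 0.
Proof.
move=> fresh exit.
suff rk j : (j <= r)%N -> (\rank (column_kernel j) <= r - j)%N.
  by apply/eqP; rewrite -mxrank_eq0 -leqn0 -(subnn r) rk.
elim: j => [_|j IH jr]; first by rewrite subn0 rank_leq_row.
have [N0|N0] := eqVneq (column_kernel j) 0.
  have := submx_trans (column_kernelS j) (annul_sub _ _).
  by move=> /mxrankS; rewrite N0 mxrank0 leqn0 => /eqP ->.
suff Nd : column_kernel j *m trunc j (j + n) != 0.
  rewrite -ltnS -subSn// subSS (leq_trans _ (IH (ltnW jr)))//.
  exact: leq_ltn_trans (mxrankS (column_kernelS j)) (rank_annul_lt Nd).
have [k0 k0j Gk0] := exit j jr N0.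
case: (ex_minnP (ex_intro (fun k => column_kernel j *m Gam k != 0) k0 Gk0)).
move=> k Gk kmin.
have kj : (k < j + n)%N by rewrite (leq_ltn_trans _ k0j)// kmin.
have NF : (column_kernel j <= fresh_kernel j k)%MS.
  rewrite sub_fresh_kernel// submx_refl andbT; apply/sub_kermx_mxrow => i.
  by apply/eqP; apply: contraTT (ltn_ord i); rewrite -leqNgt; exact: kmin.
have := submx_refl (fresh_kernel j k).
rewrite sub_fresh_kernel// => /andP[/sub_kermx_mxrow FG /submxP[z FE]].
have FGk : fresh_kernel j k *m Gam k != 0.
  apply: contraNneq Gk => FG0; have /submxP[z' ->] := NF.
  by rewrite -mulmxA FG0 mulmx0.
apply: contraNneq (fresh j k jr kj FGk) => Nd.
rewrite -trunc_split; first by rewrite FE -mulmxA Nd mulmx0.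
move=> i ilt; have ik : (i < k)%N by lia.
exact: (FG (Ordinal ik)).
Qed.

End RankDrop.

Section DrivenColumns.
Context {R : realType}.
Variables (n l : nat) (Phi : 'M[R]_n) (G : 'M[R]_(n, l)).
Variables (xh : nat -> 'cV[R]_n) (y : nat -> 'cV[R]_l) (t : nat).

Definition shock_gain (i : nat) : 'M[R]_(n + \sum_(k < n) l, l) :=
  if (i < n)%N
  then col_mx 0 (\mxcol_(k < n) (((k + i).+1 == n)%:R%:M : 'M[R]_l))
  else col_mx (Phi ^+ (i - n) *m G) 0.

Definition free_part (j : nat) : 'cV[R]_(n + \sum_(k < n) l) :=
  col_mx (Phi ^+ j *m xh t) 0.

Let eta e := y (t + 1 + e)%N.
Hypothesis xhS : forall s, xh s.+1 = Phi *m xh s + G *m y s.+1.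

Lemma driven_state j :
  xh (t + j) = Phi ^+ j *m xh t + \sum_(e < j) Phi ^+ (j - 1 - e) *m G *m eta e.
Proof.
elim: j => [|j IH]; first by rewrite addn0 expr0 mul1mx big_ord0 addr0.
rewrite addnS xhS IH mulmxDr mulmxA -[_ *m Phi ^+ j]/(Phi * Phi ^+ j) -exprS.
rewrite -addrA; congr (_ + _).
rewrite big_ord_recr /= (_ : j.+1 - 1 - j = 0)%N; last by lia.
rewrite expr0 mul1mx {3}/eta addn1 addSn; congr (_ + _).
rewrite mulmx_sumr; apply: eq_bigr => e _; rewrite !mulmxA; congr (_ *m _ *m _).
rewrite -[_ *m Phi ^+ _]/(Phi * Phi ^+ (j - 1 - e)) -exprS; congr (_ ^+ _).
by have := ltn_ord e; lia.
Qed.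

Lemma usubmx_shock_gain i :
  usubmx (shock_gain i) = if (i < n)%N then 0 else Phi ^+ (i - n) *m G.
Proof. by rewrite /shock_gain; case: ifP => _; rewrite col_mxKu. Qed.

Lemma submxcol_shock_gain i (k : 'I_n) :
  submxcol (dsubmx (shock_gain i)) k = ((k + i).+1 == n)%:R%:M.
Proof.
rewrite /shock_gain; case: ltnP => ni; rewrite col_mxKd ?mxcolK//.
by rewrite submxcol0 (_ : _ == n = false) ?scalemx0 ?raddf0//; lia.
Qed.

Lemma trunc_driven j : trunc n free_part shock_gain eta j (j + n) =
  col_mx (xh (t + j)) (stack n y (t + j + 1)).
Proof.
rewrite -[LHS]vsubmxK /trunc -(big_mkord (fun i => (i < j + n)%N)
  (fun i => shock_gain (j + n - 1 - i) *m eta i)).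
congr col_mx.
  rewrite linearD /= col_mxKu driven_state; congr (_ + _).
  rewrite linear_sum (big_cat_nat (leq0n j) (leq_addr n j)) /=.
  rewrite [X in _ + X]big1_seq ?addr0; last first.
    move=> e /andP[ejn]; rewrite mem_index_iota => /andP[je _].
    rewrite -mul_usub_mx usubmx_shock_gain ifT ?mul0mx//; lia.
  rewrite -(big_mkord xpredT (fun e => Phi ^+ (j - 1 - e) *m G *m eta e)).
  rewrite big_nat_cond [RHS]big_nat_cond.
  apply: eq_big => e; first by apply/idP/idP => /=; lia.
  move=> elt; rewrite -mul_usub_mx usubmx_shock_gain ifF; last by lia.
  by congr (_ ^+ _ *m _ *m _); lia.
rewrite linearD /= col_mxKd add0r linear_sum /=; apply/mxcolP => k.
have klt := ltn_ord k; have jk : (j + k < j + n)%N by lia.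
rewrite /stack mxcolK big_mkord submxcol_sum (bigD1 (Ordinal jk))//=.
rewrite -mul_dsub_mx -submxcol_mul submxcol_shock_gain.
rewrite (_ : (_ == n) = true) ?mul1mx; last by lia.
rewrite big1 ?addr0; first by rewrite /eta; congr (y _); lia.
move=> e /andP[ejn ejk].
rewrite -mul_dsub_mx -submxcol_mul submxcol_shock_gain.
rewrite (_ : (_ == n) = false) ?raddf0 ?mul0mx//.
apply/negbTE/eqP => E; case/eqP: ejk; apply: val_inj => /=.
by have := ltn_ord e; lia.
Qed.

Lemma driven_shock j : (n <= \sum_(k < n) l)%N ->
  (forall p : 'rV[R]_n, p != 0 ->
    (forall i, (i < n)%N -> p *m (Phi ^+ i *m G) = 0) ->
    exists2 i, (i < n)%N & p *m xh (t + i) != 0) ->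
  (j < n + \sum_(k < n) l)%N ->
  column_kernel n free_part shock_gain eta j != 0 ->
  exists2 k, (k < j + n)%N &
    column_kernel n free_part shock_gain eta j *m shock_gain k != 0.
Proof.
move=> nl good jr; set N := column_kernel _ _ _ _ _ => N0.
apply: contrapT => noshock.
have NG k : (k < j + n)%N -> N *m shock_gain k = 0.
  by move=> kj; apply: contrapT => /eqP Nk; apply: noshock; exists k.
have rN : rsubmx N = 0.
  apply/mxrowP => k; rewrite submxrow0.
  have klt := ltn_ord k.
  have /NG : (n - 1 - k < j + n)%N by lia.
  rewrite /shock_gain ifT; last by lia.
  rewrite -{1}[N]hsubmxK mul_row_col mulmx0 add0r -{1}[rsubmx N]submxrowK.
  rewrite mul_mxrow_mxcol => E.
  rewrite -[RHS]E [RHS](bigD1 k)//= (_ : (_ == n) = true); last by lia.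
  rewrite mulmx1 [X in _ + X]big1 ?addr0// => i ik.
  rewrite (_ : (_ == n) = false) ?raddf0 ?mulmx0//.
  by apply/negbTE/eqP => ikn; case/eqP: ik; apply: val_inj => /=; lia.
have NE : N = lsubmx N *m row_mx 1%:M 0.
  by rewrite mul_mx_row mulmx1 mulmx0 -rN hsubmxK.
have nj : (n <= j)%N.
  have := rank_annihilator_ge (1%:M : 'M[R]_(n + \sum_(k < n) l))
    [seq trunc n free_part shock_gain eta i (i + n) | i <- iota 0 j].
  rewrite mxrank1 size_map size_iota -/(column_kernel _ _ _ _ _) -/N => le.
  have : (\rank N <= n)%N.
    by rewrite NE (leq_trans (mxrankM_maxl _ _))// rank_leq_col.
  lia.
have [i rNi] : exists i, row i N != 0.
  apply: contrapT => noi; case/eqP: N0; apply/row_matrixP => i.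
  by rewrite row0; apply: contrapT => /eqP ri; apply: noi; exists i.
have [p pE] : exists p, row i N = row_mx p 0.
  exists (lsubmx (row i N)); rewrite -[LHS]hsubmxK; congr row_mx.
  transitivity (row i (rsubmx N)); last by rewrite rN row0.
  by apply/rowP => k; rewrite !mxE.
have p0 : p != 0 by apply: contraNneq rNi => p0; rewrite pE p0 row_mx0.
have [k kn|k kn] := good _ p0.
  have /NG : (n + k < j + n)%N by lia.
  rewrite /shock_gain ifF; last by lia.
  rewrite addKn => /(congr1 (row i)); rewrite row_mul row0 pE mul_row_col.
  by rewrite mul0mx addr0.
case/eqP.
have := row_sub i N; rewrite sub_annihilator all_map => /andP[_ /allP /(_ k)].
rewrite mem_iota /= (leq_trans kn nj) => /(_ isT).
by rewrite trunc_driven pE mul_row_col mul0mx addr0 => /eqP.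
Qed.

End DrivenColumns.

(** * Single-output observability *)

Section CyclicOutput.

Lemma finite_divisors (F : fieldType) (p : {poly F}) : p != 0 ->
  exists s : seq {poly F},
    forall g, (g %| p)%R -> exists2 h, h \in s & (g %= h)%R.
Proof.
have [k] := ubnP (size p); elim: k p => // k IH p sp p0.
have [[f fp /andP[f1 fsp]]|nof] :=
    pselect (exists2 f, (f %| p)%R & (1 < size f < size p)%N).
  have [q pE] := dvdpP _ _ fp.
  have f0 : f != 0 by rewrite -size_poly_gt0 (ltn_trans _ f1).
  have q0 : q != 0 by apply: contraNneq p0 => q0; rewrite pE q0 mul0r.
  have q1 : (0 < size q)%N by rewrite size_poly_gt0.
  have sE : size p = (size q + size f).-1 by rewrite pE size_mul.
  have [s1 s1P] : exists s : seq {poly F},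
      forall g, (g %| q)%R -> exists2 h, h \in s & (g %= h)%R.
    by apply: IH => //; lia.
  have [s2 s2P] : exists s : seq {poly F},
      forall g, (g %| f)%R -> exists2 h, h \in s & (g %= h)%R.
    by apply: IH => //; exact: leq_trans fsp sp.
  exists [seq a * b | a <- s1, b <- s2] => g gp.
  have gq0 : gcdp g q != 0 by rewrite gcdp_eq0 negb_and q0 orbT.
  have [h1 h1s e1] := s1P _ (dvdp_gcdr g q).
  have [|h2 h2s e2] := s2P (g %/ gcdp g q)%R.
    rewrite -(@Gauss_dvdpr _ _ (q %/ gcdp g q)%R).
      rewrite -(dvdp_mul2l _ _ gq0) mulrA -![gcdp g q * _]mulrC.
      by rewrite !divpK ?dvdp_gcdl ?dvdp_gcdr// -pE.
    by rewrite coprimep_div_gcd// q0 orbT.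
  exists (h1 * h2); first by apply/allpairsP; exists (h1, h2).
  rewrite -(divpK (dvdp_gcdl g q)) mulrC.
  by apply: eqp_trans (eqp_mulr _ e1) (eqp_mull _ e2).
exists [:: 1; p] => g gp.
have g0 : g != 0 by apply: contraNneq p0 => g0; move: gp; rewrite g0 dvd0p.
have [g1|g1] := leqP (size g) 1.
  exists 1; rewrite ?mem_head// -size_poly_eq1 eqn_leq g1.
  by rewrite size_poly_gt0.
exists p; first by rewrite !inE eqxx orbT.
rewrite -(dvdp_size_eqp gp) eqn_leq dvdp_leq//= leqNgt; apply/negP => lt.
by apply: nof; exists g; rewrite // g1.
Qed.

Lemma horner_mx_vanish (F : fieldType) n m (A : 'M[F]_n.+1) (p : 'rV[F]_n.+1)
    (v : 'M[F]_(n.+1, m)) (h : {poly F}) :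
  (forall i, (i < n.+1)%N -> p *m (A ^+ i *m v) = 0) ->
  p *m (horner_mx A h *m v) = 0.
Proof.
move=> pv; rewrite (divp_eq h (char_poly A)) rmorphD rmorphM /= Cayley_Hamilton.
rewrite mulr0 add0r -[(h %% _)%R]coefK poly_def rmorph_sum /=.
rewrite mulmx_suml mulmx_sumr.
apply: big1 => i _; rewrite linearZ /= rmorphXn /= horner_mx_X.
rewrite -scalemxAl -scalemxAr pv ?scaler0// (leq_trans (ltn_ord i))//.
rewrite -ltnS -(size_char_poly A) ltn_modp.
by rewrite -size_poly_gt0 size_char_poly.
Qed.

(* The row space is the cyclic module F[Phi] K, whose submodules are generated
   by the K g(Phi) with g dividing the characteristic polynomial. *)
Lemma cyclic_submodule_generators (R : realType) n (Phi : 'M[R]_n)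
    (K : 'rV[R]_n) : observable Phi K ->
  exists2 s : seq 'rV[R]_n, (forall h, h \in s -> h != 0) &
    forall p : 'rV[R]_n, p != 0 -> exists2 h, h \in s &
      forall m (v : 'M[R]_(n, m)),
        (forall i, (i < n)%N -> p *m (Phi ^+ i *m v) = 0) ->
        forall i, h *m (Phi ^+ i *m v) = 0.
Proof.
case: n Phi K => [|n] Phi K obs.
  by exists [::] => // p; rewrite [p]thinmx0 eqxx.
have char0 : char_poly Phi != 0 by rewrite -size_poly_gt0 size_char_poly.
have [s0 s0P] := finite_divisors char0.
exists [seq h <- [seq K *m horner_mx Phi g | g <- s0] | h != 0].
  by move=> h; rewrite mem_filter => /andP[].
move=> p p0.
have [q pE] : exists q : {poly R}, p = K *m horner_mx Phi q.
  have /submxP[z ->] : (p <= \mxcol_(k < n.+1) (K *m Phi ^+ k))%MS.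
    by apply: submx_full; rewrite /row_full; apply/eqP.
  exists (\sum_k (submxrow z k) 0 0 *: 'X^k).
  rewrite -{1}[z]submxrowK mul_mxrow_mxcol rmorph_sum /= mulmx_sumr.
  apply: eq_bigr => k _; rewrite linearZ /= rmorphXn /= horner_mx_X -scalemxAr.
  by rewrite {1}[submxrow z k]mx11_scalar mul_scalar_mx.
have [h hs gh] := s0P _ (dvdp_gcdr q (char_poly Phi)).
have [[u1 u2] /= uq] := Bezoutp q (char_poly Phi).
have /eqpP[[c1 c2] /= /andP[c10 c20] cE] := eqp_trans uq gh.
have hE : h = c2^-1 *: (c1 *: (u1 * q + u2 * char_poly Phi)).
  by rewrite cE scalerA mulVf// scale1r.
have Kh : K *m horner_mx Phi h = (c2^-1 * c1) *: (p *m horner_mx Phi u1).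
  rewrite hE scalerA linearZ rmorphD !rmorphM /= Cayley_Hamilton mulr0 addr0.
  rewrite -scalemxAr pE -mulmxA -[_ *m horner_mx Phi u1]rmorphM /=.
  by rewrite -rmorphM /= [u1 * q]mulrC.
exists (K *m horner_mx Phi h).
  rewrite mem_filter (map_f (fun g => K *m horner_mx Phi g) hs) andbT.
  apply: contraNneq p0 => Kh0.
  have : (h %| q)%R by rewrite -(eqp_dvdl _ gh) dvdp_gcdl.
  move=> /dvdpP[q' qE]; rewrite pE qE mulrC rmorphM /=.
  by rewrite -[_ * horner_mx Phi q']/(_ *m _) mulmxA Kh0 mul0mx.
move=> m v pv i; rewrite Kh -scalemxAl -mulmxA (mulmxA (horner_mx Phi u1)).
have -> : horner_mx Phi u1 *m Phi ^+ i = horner_mx Phi (u1 * 'X^i).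
  by rewrite rmorphM /= rmorphXn /= horner_mx_X.
by rewrite horner_mx_vanish ?scaler0.
Qed.

Lemma observableP (R : realType) n l (A : 'M[R]_n) (C : 'M[R]_(l, n)) :
  observable A C <->
  forall z : 'cV[R]_n, (forall k, (k < n)%N -> C *m (A ^+ k *m z) = 0) -> z = 0.
Proof.
have outE (z : 'cV[R]_n) : (\mxcol_(k < n) (C *m A ^+ k)) *m z = 0 <->
    forall k, (k < n)%N -> C *m (A ^+ k *m z) = 0.
  rewrite mxcol_mul; split=> [E k kn|E].
    have := mxcolK (fun k : 'I_n => C *m A ^+ k *m z) (Ordinal kn).
    by rewrite E submxcol0 /= mulmxA.
  rewrite (eq_mxcol (_ : forall k, _ = 0)) ?mxcol0// => k.
  by rewrite -mulmxA E.
rewrite /observable; split=> [/eqP rkO z /outE Oz|inj].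
  have : row_free (\mxcol_(k < n) (C *m A ^+ k))^T.
    by rewrite /row_free mxrank_tr.
  move=> /row_free_inj inj; apply: trmx_inj; rewrite trmx0; apply: inj.
  by rewrite mul0mx -trmx_mul Oz trmx0.
apply/eqP; rewrite -mxrank_tr -[_ == _]/(row_free _) -kermx_eq0.
apply/rowV0P => w.
move=> /sub_kermxP /(congr1 trmx); rewrite trmx_mul trmxK trmx0 => /outE /inj.
by move=> /(congr1 trmx); rewrite trmxK trmx0.
Qed.

Lemma observable_feedback (R : realType) n m (E : 'M[R]_n) (F : 'M[R]_(n, m))
    (K : 'M[R]_(m, n)) : observable E K -> observable (E + F *m K) K.
Proof.
move=> /observableP obs; apply/observableP => z Kz; apply: obs.
suff EP k : (k <= n)%N -> (E + F *m K) ^+ k *m z = E ^+ k *m z.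
  by move=> k kn; rewrite -EP ?(ltnW kn)// Kz.
elim: k => [//|k IH kn].
rewrite !exprS -[X in X *m z]/(_ *m _) -[X in _ = X *m z]/(_ *m _) -!mulmxA.
by rewrite mulmxDl -(mulmxA F) Kz// mulmx0 addr0 IH// ltnW.
Qed.

Lemma observable_single_free (R : realType) n (Phi : 'M[R]_n) (K : 'rV[R]_n)
    m (p : 'M[R]_(m, _)) :
  observable Phi K -> p *m \mxcol_(k < n) (K *m Phi ^+ k) = 0 -> p = 0.
Proof.
move=> obs pO.
have free : row_free (\mxcol_(k < n) (K *m Phi ^+ k)).
  by rewrite /row_free obs sum_nat_const card_ord muln1.
by apply: (row_free_inj free); rewrite mul0mx.
Qed.

End CyclicOutput.

(** * Stacked trajectories and the estimation matrix *)

Section Stacks.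
Context {R : realType}.

Lemma estM_stack n q (E : 'M[R]_n) (G : 'M[R]_(n, q)) (z : nat -> 'cV[R]_q) s :
  estM E G *m stack n z s =
  \mxcol_(i < n) \sum_(j < i) E ^+ (i - j - 1) *m G *m z (s + j)%N.
Proof.
rewrite /estM mxblockEv mxcol_mul; apply: eq_mxcol => i.
rewrite mul_mxrow_mxcol (big_ord_widen n (fun j => E ^+ (i - j - 1) *m G *m
  z (s + j)%N) (ltnW (ltn_ord i))) [RHS]big_mkcond.
by apply: eq_bigr => j _; case: ifP => // _; rewrite mul0mx.
Qed.

Lemma stack_driven n l (E : 'M[R]_n) (G : 'M[R]_(n, l)) (z : nat -> 'cV[R]_n)
    (y : nat -> 'cV[R]_l) s :
  (forall s, z s.+1 = E *m z s + G *m y s.+1) ->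
  stack n z s = (\mxcol_(k < n) E ^+ k) *m z s + estM E G *m stack n y (s + 1).
Proof.
move=> zS; rewrite estM_stack mxcol_mul -mxcolD; apply: eq_mxcol => k.
rewrite (driven_state s zS); congr (_ + _); apply: eq_bigr => j _.
by rewrite subnAC.
Qed.

Lemma kron_id_stack n q (a : 'rV[R]_n) (z : 'I_n -> 'cV[R]_q) :
  kron_id a q *m (\mxcol_(j < n) z j) = \sum_(j < n) a 0 j *: z j.
Proof.
rewrite mul_mxrow_mxcol; apply: eq_bigr => j _; exact: mul_scalar_mx.
Qed.

Lemma controlled_state n m l (E : 'M[R]_n) (F : 'M[R]_(n, m))
    (G : 'M[R]_(n, l)) (z : nat -> 'cV[R]_n) (u : nat -> 'cV[R]_m)
    (y : nat -> 'cV[R]_l) s k :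
  (forall s, z s.+1 = E *m z s + F *m u s + G *m y s.+1) ->
  z (s + k)%N = E ^+ k *m z s +
    (\sum_(j < k) E ^+ (k - j - 1) *m F *m u (s + j)%N +
     \sum_(j < k) E ^+ (k - j - 1) *m G *m y (s + 1 + j)%N).
Proof.
move=> zS.
pose uy s := col_mx (u s.-1) (y s).
have zS' s' : z s'.+1 = E *m z s' + row_mx F G *m uy s'.+1.
  by rewrite mul_row_col addrA -zS.
rewrite (driven_state (y := uy) s zS') -big_split; congr (_ + _).
apply: eq_bigr => j _ /=; rewrite subnAC -!mulmxA mul_row_col mulmxDr.
by rewrite addn1 addSn.
Qed.

Lemma Lest_predict n m l (E : 'M[R]_n) (F : 'M[R]_(n, m)) (G : 'M[R]_(n, l))
    (K : 'M[R]_(m, n)) (a : 'rV[R]_n) (z : nat -> 'cV[R]_n)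
    (u : nat -> 'cV[R]_m) (y : nat -> 'cV[R]_l) s :
  E ^+ n = \sum_(k < n) a 0 k *: E ^+ k ->
  (forall s, z s.+1 = E *m z s + F *m u s + G *m y s.+1) ->
  (forall s, u s = K *m z s) ->
  row_mx K 1%:M *m Lest E F G a *m col_mx (stack n u s) (stack n y (s + 1)) =
  u (s + n)%N.
Proof.
move=> Ea zS uE.
rewrite -mulmxA /Lest mul_block_col mul0mx addr0 mul_row_col mul1mx.
rewrite !mulmxBl addrACA -opprD -!mulmxA -mulmxDr !estM_stack -mxcolD.
rewrite (kron_id_stack a (fun k : 'I_n => u (s + k)%N)) kron_id_stack.
rewrite /estF !mul_mxrow_mxcol.
set FU := \sum_(i < n) _; set FY := \sum_(i < n) _.
have -> : FU + FY = z (s + n)%N - E ^+ n *m z s.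
  rewrite (controlled_state s n zS) [RHS]addrC addKr /FU /FY.
  by congr (_ + _); apply: eq_bigr => j _; rewrite subnAC.
rewrite (eq_bigr (fun j : 'I_n => a 0 j *: z (s + j)%N -
    a 0 j *: (E ^+ j *m z s))) => [|j _]; last first.
  by rewrite (controlled_state s j zS) [in RHS]scalerDr [RHS]addrC addKr.
rewrite sumrB (_ : \sum_(j < n) a 0 j *: (E ^+ j *m z s) = E ^+ n *m z s).
  rewrite opprB addrA subrK mulmxBr -uE mulmx_sumr -addrA -[RHS]addr0.
  congr (_ + _); apply/eqP; rewrite addrC subr_eq0; apply/eqP.
  by apply: eq_bigr => j _; rewrite uE scalemxAr.
by rewrite Ea mulmx_suml; apply: eq_bigr => j _; rewrite scalemxAl.
Qed.

Lemma col_dataH n m l c (u : nat -> 'cV[R]_m) (y : nat -> 'cV[R]_l) t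
    (j : 'I_c) : col j (dataH n c u y t) =
  col_mx (stack n u (t + j)) (stack n y (t + j + 1)).
Proof.
rewrite /dataH addnAC; apply/colP => i; rewrite [LHS]mxE.
by rewrite mxE [RHS]mxE; case: (fintype.split i) => k; rewrite mxE.
Qed.

Lemma dataU_mpinv n m l c (M : 'M[R]_(m, \sum_(k < n) m + \sum_(k < n) l))
    (u : nat -> 'cV[R]_m) (y : nat -> 'cV[R]_l) t :
  (forall s, M *m col_mx (stack n u s) (stack n y (s + 1)) = u (s + n)%N) ->
  row_free (dataH n c u y t) -> dataU n c u t *m mpinv (dataH n c u y t) = M.
Proof.
move=> MP free; have -> : dataU n c u t = M *m dataH n c u y t.
  apply/matrixP => i j; rewrite mxE addnAC -MP -col_dataH.
  by rewrite colE mulmxA -colE mxE.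
have [HXH _ _ _] := mpinvP (dataH n c u y t).
rewrite -mulmxA (_ : _ *m mpinv _ = 1%:M) ?mulmx1//.
by apply: (row_free_inj free); rewrite HXH mul1mx.
Qed.

End Stacks.

(** * Randomness of a closed-loop run *)

Section Run.
Context {R : realType} {d : measure_display} {Omega : measurableType d}.
Variable P : probability Omega R.

Lemma ae_imply (Q1 Q2 : Omega -> Prop) : (forall om, Q1 om -> Q2 om) ->
  {ae P, forall om, Q1 om} -> {ae P, forall om, Q2 om}.
Proof. by move=> Q12; apply: negligibleS => om /= nQ2 /Q12. Qed.

Lemma ae_forall_countable (I : countType) (Q : I -> Omega -> Prop) :
  (forall i, {ae P, forall om, Q i om}) -> {ae P, forall om i, Q i om}.
Proof.
move=> aeQ.
pose F k := if unpickle k is Some i then ~` [set om | Q i om] else set0.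
have /negligibleS : P.-negligible (\bigcup_k F k).
  apply: negligible_bigcup => k; rewrite /F.
  by case: unpickle => [i|]; [exact: aeQ|exact: negligible_set0].
apply => om /= /existsNP[i nQ]; exists (pickle i) => //.
by rewrite /F pickleK.
Qed.

Lemma ae_conj (Q1 Q2 : Omega -> Prop) : {ae P, forall om, Q1 om} ->
  {ae P, forall om, Q2 om} -> {ae P, forall om, Q1 om /\ Q2 om}.
Proof.
move=> ae1 ae2.
have ae12 (b : bool) : {ae P, forall om, if b then Q1 om else Q2 om}.
  by case: b.
apply: ae_imply (ae_forall_countable ae12) => om Q12.
by split; [exact: (Q12 true)|exact: (Q12 false)].
Qed.

Lemma sigma_of_measurable k (X : Omega -> 'cV[R]_k) :
  random_vector X -> sigma_of X `<=` measurable.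
Proof.
move=> mX; apply: sigma_sub_measurable => _ [i [D [mD ->]]].
by rewrite -[X in measurable X]setTI; exact: mX.
Qed.

Lemma sigma_ofT k (X : Omega -> 'cV[R]_k) : sigma_of X setT.
Proof. exact: (@measurableT _ (g_sigma_algebraType _)). Qed.

Lemma sigma_ofI k (X : Omega -> 'cV[R]_k) : setI_closed (sigma_of X).
Proof. exact: (@measurableI _ (g_sigma_algebraType _)). Qed.

Lemma mx_measurable_sigma_of k (X : Omega -> 'cV[R]_k) (GG : set (set Omega)) :
  sigma_of X `<=` GG -> mx_measurable (fun om : g_sigma_algebraType GG => X om).
Proof.
move=> XG i j _ D mD; rewrite setTI (ord1 j); apply: sub_sigma_algebra.
by apply: XG; apply: sub_sigma_algebra; exists i, D.
Qed.

Variables (n m l : nat) (A : 'M[R]_n) (B : 'M[R]_(n, m)) (C : 'M[R]_(l, n)).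
Variables (W : 'M[R]_n) (V : 'M[R]_l) (K : 'M[R]_(m, n)) (L : 'M[R]_(n, l)).
Variables (w : nat -> Omega -> 'cV[R]_n) (v : nat -> Omega -> 'cV[R]_l).
Variables (x xh : nat -> Omega -> 'cV[R]_n) (u : nat -> Omega -> 'cV[R]_m).
Variable (y : nat -> Omega -> 'cV[R]_l).
Hypothesis run : lqg_run P A B C W V K L w v x xh u y.

Let E := ctrlE A C L.
Let F := ctrlF B C L.
Let Phi := E + F *m K.

Lemma run_xhS s om : xh s.+1 om = Phi *m xh s om + L *m y s.+1 om.
Proof.
by rewrite (run_xh run) (run_u run) mulmxDl -/E -/F -mulmxA.
Qed.

Lemma run_blocks_measurable j :
  run_blocks (x 0) (xh 0) w v j `<=` measurable.
Proof.
case: j => [[s|s]|]; apply: sigma_of_measurable.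
- exact: (run_w run s).1.
- exact: (run_v run s.+1).1.
- move=> i; under eq_fun do rewrite mxE.
  case: (fintype.split i) => i'; first exact: run_x0 run i'.
  under eq_fun do rewrite mxE.
  case: (fintype.split i') => i2; first exact: run_xh0 run i2.
  exact: (run_v run 0).1.
Qed.

(* Everything that is independent of v (s + 1). *)
Definition all_but_noise (s : nat) : set (set Omega) :=
  \bigcup_(j in [set~ Some (inr s)]) run_blocks (x 0) (xh 0) w v j.

Lemma all_but_noise_indep s G H : <<s all_but_noise s >> G ->
  sigma_of (v s.+1) H -> P (G `&` H) = (P G * P H)%E.
Proof.
move=> sG sH; apply: (mutually_independent_rest (run_indep run) _ _ _ sG sH).
- exact: run_blocks_measurable.
- by case=> [[?|?]|]; exact: sigma_ofT.
- by case=> [[?|?]|]; exact: sigma_ofI.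
Qed.

Lemma all_but_noise_measurable s : all_but_noise s `<=` measurable.
Proof. by move=> X [j _]; exact: run_blocks_measurable. Qed.

Section Past.
Variable s : nat.
Let TG := g_sigma_algebraType (all_but_noise s).

Lemma past_noise_measurable k : (k <= s)%N ->
  mx_measurable (fun om : TG => w k om) /\
  mx_measurable (fun om : TG => v k om).
Proof.
move=> ks; split.
  by apply: mx_measurable_sigma_of => X wX; exists (Some (inl k)).
case: k ks => [_|k ks]; last first.
  apply: mx_measurable_sigma_of => X wX; exists (Some (inr k)) => //=.
  by case=> kE; rewrite kE ltnn in ks.
have mX0 : mx_measurable
    (fun om : TG => col_mx (x 0 om) (col_mx (xh 0 om) (v 0 om))).
  by apply: mx_measurable_sigma_of => X X0; exists None.
move=> i j; have := mX0 (rshift n (rshift n i)) j.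
by under eq_fun do rewrite !col_mxEd.
Qed.

Lemma next_state_measurable k : (k <= s)%N ->
  mx_measurable (fun om : TG => x k om) ->
  mx_measurable (fun om : TG => xh k om) ->
  mx_measurable (fun om : TG => x k.+1 om).
Proof.
move=> ks mx mxh.
rewrite (_ : x k.+1 = fun om => A *m x k om + B *m (K *m xh k om) + w k om).
  apply: mx_measurableD; last exact: (past_noise_measurable ks).1.
  apply: mx_measurableD; apply: mx_measurableM => //;
    try exact: mx_measurable_cst.
  by apply: mx_measurableM => //; exact: mx_measurable_cst.
by apply/funext => om; rewrite (run_x run) (run_u run).
Qed.

Lemma past_measurable k : (k <= s)%N ->
  [/\ mx_measurable (fun om : TG => x k om),
      mx_measurable (fun om : TG => xh k om) &
      mx_measurable (fun om : TG => y k om)].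
Proof.
have my k' : (k' <= s)%N -> mx_measurable (fun om : TG => x k' om) ->
    mx_measurable (fun om : TG => y k' om).
  move=> k's mx; rewrite (_ : y k' = fun om => C *m x k' om + v k' om).
    apply: mx_measurableD; last exact: (past_noise_measurable k's).2.
    by apply: mx_measurableM => //; exact: mx_measurable_cst.
  by apply/funext => om; exact: run_y run k' om.
have mX0 : mx_measurable
    (fun om : TG => col_mx (x 0 om) (col_mx (xh 0 om) (v 0 om))).
  by apply: mx_measurable_sigma_of => X X0; exists None.
elim: k => [_|k IH ks].
  have mx0 : mx_measurable (fun om : TG => x 0 om).
    move=> i j; have := mX0 (lshift _ i) j.
    by under eq_fun do rewrite col_mxEu.
  split=> //; last exact: my.
  move=> i j; have := mX0 (rshift n (lshift _ i)) j.
  by under eq_fun do rewrite col_mxEd col_mxEu.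
have [mx mxh _] := IH (ltnW ks).
have mxS := next_state_measurable (ltnW ks) mx mxh.
split=> //; last exact: my.
rewrite (_ : xh k.+1 = fun om => Phi *m xh k om + L *m y k.+1 om).
  apply: mx_measurableD; apply: mx_measurableM; try exact: mx_measurable_cst.
    exact: mxh.
  exact: my.
by apply/funext => om; exact: run_xhS.
Qed.

Lemma fresh_output r (N : TG -> 'M[R]_r) (c : TG -> 'cV[R]_r)
    (Gam : 'M[R]_(r, l)) :
  posdef V -> mx_measurable N -> mx_measurable c ->
  {ae P, forall om, N om *m Gam != 0 ->
                    N om *m (c om + Gam *m y s.+1 om) != 0}.
Proof.
move=> posV mN mc.
have rowP i : {ae P, forall om, row i (N om *m Gam) != 0 ->
    row i (N om *m (c om + Gam *m y s.+1 om)) != 0}.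
  pose q (om : TG) := row i (N om *m Gam).
  pose c0 (om : TG) : R := (N om *m (c om + Gam *m (C *m x s.+1 om))) i 0.
  have mNG : mx_measurable (fun om => N om *m Gam).
    by apply: mx_measurableM => //; exact: mx_measurable_cst.
  have mq j : measurable_fun setT (fun om => q om 0 j).
    by under eq_fun do rewrite mxE; exact: mNG.
  have mc0 : measurable_fun setT c0.
    apply: mx_measurableM => //; apply: mx_measurableD => //.
    apply: mx_measurableM; first exact: mx_measurable_cst.
    apply: mx_measurableM; first exact: mx_measurable_cst.
    have [mx mxh _] := past_measurable (leqnn s).
    exact: (next_state_measurable (leqnn s) mx mxh).
  apply: ae_imply (gaussian_fresh posV (run_v run s.+1)
    (@all_but_noise_measurable s) (@all_but_noise_indep s) mq mc0) => om imp q0.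
  apply: contraNneq (imp q0) => r0.
  have NyE : N om *m (c om + Gam *m y s.+1 om) =
      N om *m Gam *m v s.+1 om + N om *m (c om + Gam *m (C *m x s.+1 om)).
    by rewrite (run_y run) !mulmxDr !mulmxA addrCA [RHS]addrC -addrA addrCA.
  apply/eqP; transitivity (row i (N om *m (c om + Gam *m y s.+1 om)) 0 0).
    by rewrite NyE [RHS]mxE [RHS]mxE /q /c0 -row_mul [row _ _ _ _]mxE.
  by rewrite r0 mxE.
apply: ae_imply (ae_forall_countable rowP) => om rowP0.
apply: contraNneq => Ny0; apply/eqP/row_matrixP => i; rewrite row0.
by apply/eqP; apply: contraT => /rowP0; rewrite Ny0 row0 eqxx.
Qed.

End Past.

Lemma ae_fresh_kernel t : posdef V ->
  {ae P, forall om (j k : nat), (k < j + n)%N ->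
    let b := free_part l Phi (fun s => xh s om) t in
    let eta := fun e => y (t + 1 + e)%N om in
    let N := fresh_kernel n b (shock_gain Phi L) eta j k in
    N *m shock_gain Phi L k != 0 ->
    N *m trunc n b (shock_gain Phi L) eta j (j + n - k) != 0}.
Proof.
move=> posV; apply: ae_forall_countable => j; apply: ae_forall_countable => k.
have [kj|jk] := ltnP k (j + n); last exact: aeW.
set e := (j + n - 1 - k)%N.
pose TG := g_sigma_algebraType (all_but_noise (t + e)).
have mtrunc i : mx_measurable (fun om : TG =>
    trunc n (free_part l Phi (fun s => xh s om) t) (shock_gain Phi L)
      (fun e => y (t + 1 + e)%N om) i e).
  have [_ mxh _] := past_measurable (leq_addr e t).
  apply: mx_measurableD.
    apply: mx_measurable_col_mx; last exact: mx_measurable_cst.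
    by apply: mx_measurableM => //; exact: mx_measurable_cst.
  apply: mx_measurable_sum => i' _.
  apply: mx_measurableM; first exact: mx_measurable_cst.
  have : (t + 1 + i' <= t + e)%N by have := ltn_ord i'; lia.
  by move=> /past_measurable[].
have mN : mx_measurable (fun om : TG =>
    fresh_kernel n (free_part l Phi (fun s => xh s om) t) (shock_gain Phi L)
      (fun e => y (t + 1 + e)%N om) j k).
  apply: mx_measurable_annihilator; first exact: mx_measurable_cst.
  by move=> i _; exact: mtrunc.
apply: ae_imply (fresh_output (shock_gain Phi L k) posV mN (mtrunc j)).
move=> om /= imp _ /imp; rewrite (_ : j + n - k = e.+1)%N; last by lia.
rewrite truncS; last by lia.
rewrite (_ : j + n - 1 - e = k)%N; last by lia.
by rewrite addn1 addSn.
Qed.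

End Run.

Section SingleInputRun.
Context {R : realType} {d : measure_display} {Omega : measurableType d}.
Variable P : probability Omega R.
Variables (n l : nat) (A : 'M[R]_n) (B : 'M[R]_(n, 1)) (C : 'M[R]_(l, n)).
Variables (W : 'M[R]_n) (V : 'M[R]_l) (K : 'rV[R]_n) (L : 'M[R]_(n, l)).
Variables (w : nat -> Omega -> 'cV[R]_n) (v : nat -> Omega -> 'cV[R]_l).
Variables (x xh : nat -> Omega -> 'cV[R]_n) (u : nat -> Omega -> 'cV[R]_1).
Variable (y : nat -> Omega -> 'cV[R]_l).
Hypothesis run : lqg_run P A B C W V K L w v x xh u y.

Let E := ctrlE A C L.
Let F := ctrlF B C L.
Let Phi := E + F *m K.

Hypotheses (posV : posdef V) (obsEK : observable E K).
Hypothesis ctrlEL : controllable E L.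
Variables (t T : nat).
Hypothesis nconf : not_confined P xh t T.

Lemma ae_excited : {ae P, forall om (p : 'rV[R]_n), p != 0 ->
  (forall i, (i < n)%N -> p *m (Phi ^+ i *m L) = 0) ->
  exists2 i, (i < n)%N & p *m xh (t + i)%N om != 0}.
Proof.
have [s s0 gen] := cyclic_submodule_generators (observable_feedback F obsEK).
have ae_s : {ae P, forall om (i : 'I_(size s)),
    exists2 s', (t <= s' <= t + T)%N & s`_i *m xh s' om != 0}.
  by apply: ae_forall_countable => i; apply: nconf; apply: s0; exact: mem_nth.
apply: ae_imply ae_s => om exc p p0 pL; apply: contrapT => nop.
have px i : (i < n)%N -> p *m xh (t + i)%N om = 0.
  by move=> ilt; apply: contrapT => /eqP pi; apply: nop; exists i.
have unroll j :=
  driven_state (y := fun s => y s om) t (fun s => run_xhS run s om) j.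
have [h hs hP] := gen p p0.
have hL := hP _ L pL.
have hx i : h *m (Phi ^+ i *m xh t om) = 0.
  apply: hP => {}i ilt; have := px i ilt; rewrite unroll mulmxDr mulmx_sumr.
  rewrite big1 ?addr0// => e _; rewrite mulmxA pL ?mul0mx//.
  by have := ltn_ord e; lia.
have [s' /andP[ts' _]] := exc (Ordinal (etrans (index_mem h s) hs)).
rewrite /= nth_index// -(subnKC ts') unroll mulmxDr hx add0r mulmx_sumr.
by rewrite big1 ?eqxx// => e _; rewrite mulmxA hL mul0mx.
Qed.

Lemma controllable_width : (n <= \sum_(k < n) l)%N.
Proof. by rewrite -[X in (X <= _)%N]ctrlEL rank_leq_col. Qed.

Lemma ae_no_annihilator : {ae P, forall om (p : 'rV[R]_(n + \sum_(k < n) l)),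
  (forall j, (j < n + \sum_(k < n) l)%N ->
    p *m col_mx (xh (t + j)%N om)
                (stack n (fun s => y s om) (t + j + 1)) = 0) ->
  p = 0}.
Proof.
apply: ae_imply (ae_conj (ae_fresh_kernel run t posV) ae_excited) => om.
move=> [fresh exc] p pd.
have xhS s : xh s.+1 om = Phi *m xh s om + L *m (fun s => y s om) s.+1.
  exact: run_xhS run s om.
suff N0 : column_kernel n (free_part l Phi (fun s => xh s om) t)
    (shock_gain Phi L) (fun e => y (t + 1 + e)%N om) (n + \sum_(k < n) l) = 0.
  apply/eqP; rewrite -submx0 -N0 sub_annihilator submx1 all_map; apply/allP.
  move=> j; rewrite mem_iota /= => jr.
  by rewrite (trunc_driven (y := fun s => y s om) t xhS) pd.
apply: column_kernel_eq0 => [j k _ kj|j jr]; first exact: fresh.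
exact: (@driven_shock _ _ _ _ _ _ (fun s => y s om) _ xhS _
  controllable_width exc jr).
Qed.

Lemma ae_row_free_dataH c : (n + \sum_(k < n) l <= c)%N ->
  {ae P, forall om,
    row_free (dataH n c (fun s => u s om) (fun s => y s om) t)}.
Proof.
move=> rc; apply: ae_imply ae_no_annihilator => om noann.
rewrite -kermx_eq0; apply/rowV0P => p /sub_kermxP pH.
have pHj j : (j < c)%N ->
    lsubmx p *m stack n (fun s => u s om) (t + j) +
    rsubmx p *m stack n (fun s => y s om) (t + j + 1) = 0.
  move=> jc; rewrite -mul_row_col hsubmxK -(col_dataH _ _ _ _ (Ordinal jc)).
  by rewrite colE mulmxA pH mul0mx.
pose pX : 'rV[R]_(\sum_(k < n) n) :=
  \mxrow_(k < n) (submxrow (lsubmx p) k *m K).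
have pXu s : lsubmx p *m stack n (fun s => u s om) s =
    pX *m stack n (fun s => xh s om) s.
  rewrite -{1}[lsubmx p]submxrowK !mul_mxrow_mxcol.
  by apply: eq_bigr => k _; rewrite (run_u run) mulmxA.
have xhE s : stack n (fun s => xh s om) s =
    (\mxcol_(k < n) Phi ^+ k) *m xh s om +
    estM Phi L *m stack n (fun s => y s om) (s + 1).
  apply: stack_driven => s'; exact: run_xhS run s' om.
have /noann : forall j, (j < n + \sum_(k < n) l)%N ->
    row_mx (pX *m \mxcol_(k < n) Phi ^+ k) (pX *m estM Phi L + rsubmx p) *m
    col_mx (xh (t + j)%N om) (stack n (fun s => y s om) (t + j + 1)) = 0.
  move=> j jr; rewrite mul_row_col mulmxDl addrA -!(mulmxA pX) -mulmxDr -xhE.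
  by rewrite -pXu pHj// (leq_trans jr).
rewrite -row_mx0 => /eq_row_mx[pX0 pY0].
have pu0 : lsubmx p = 0.
  apply: (observable_single_free (observable_feedback F obsEK)).
  rewrite -[RHS]pX0 -{1}[lsubmx p]submxrowK !mul_mxrow_mxcol.
  by apply: eq_bigr => k _; rewrite mulmxA.
rewrite -[p]hsubmxK pu0 -[RHS]row_mx0; congr row_mx.
rewrite -[RHS]pY0 (_ : pX = 0) ?mul0mx ?add0r//.
by apply/mxrowP => k; rewrite mxrowK pu0 !submxrow0 mul0mx.
Qed.

End SingleInputRun.

Theorem theorem3p3 (R : realType) (d : measure_display)
    (Omega : measurableType d) (P : probability Omega R) (n l N : nat)
    (A : 'M[R]_n) (B : 'M[R]_(n, 1)) (C : 'M[R]_(l, n))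
    (W Whalf : 'M[R]_n) (V : 'M[R]_l)
    (psdW : psd W) (posV : posdef V) (sqrtW : is_psd_sqrt W Whalf)
    (ctrlAB : controllable A B) (ctrlAW : controllable A Whalf)
    (obsAC : observable A C)
    (Lf : 'M[R]_(n, l)) (kalman : is_kalman_gain A C W V Lf)
    (Q Qhalf : 'I_N -> 'M[R]_n) (Rw : 'I_N -> 'M[R]_1)
    (psdQ : forall i, psd (Q i)) (posR : forall i, posdef (Rw i))
    (sqrtQ : forall i, is_psd_sqrt (Q i) (Qhalf i))
    (obsAQ : forall i, observable A (Qhalf i))
    (K : 'I_N -> 'M[R]_(1, n))
    (lqr : forall i, is_lqr_gain A B (Q i) (Rw i) (K i))
    (obsEK : forall i (k : 'I_1), observable (ctrlE A C Lf) (row k (K i)))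
    (ctrlEL : controllable (ctrlE A C Lf) Lf)
    (a : 'rV[R]_n)
    (ha : ctrlE A C Lf ^+ n = \sum_(k < n) a 0 k *: ctrlE A C Lf ^+ k)
    (w : 'I_N -> nat -> Omega -> 'cV[R]_n)
    (v : 'I_N -> nat -> Omega -> 'cV[R]_l)
    (x xh : 'I_N -> nat -> Omega -> 'cV[R]_n)
    (u : 'I_N -> nat -> Omega -> 'cV[R]_1)
    (y : 'I_N -> nat -> Omega -> 'cV[R]_l)
    (run : forall i,
       lqg_run P A B C W V (K i) Lf (w i) (v i) (x i) (xh i) (u i) (y i))
    (t T : nat) (hT : (n * (l + 2) - 1 <= T)%N)
    (nconf : forall i, not_confined P (xh i) t T)
    (kerK : \bigcap_(i in [set: 'I_N])
       Ker (row_mx (K i) (1%:M : 'M[R]_1)) = [set 0]) :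
  {ae P, forall om : Omega,
     Ker (Lest (ctrlE A C Lf) (ctrlF B C Lf) Lf a) =
     \bigcap_(i in [set: 'I_N])
       Ker (dataU n (T - n + 1) (fun s => u i s om) t *m
            mpinv (dataH n (T - n + 1) (fun s => u i s om)
                    (fun s => y i s om) t))}.
Proof.
have rank_le : (n + \sum_(k < n) l <= T - n + 1)%N.
  rewrite sum_nat_const card_ord; move: hT.
  case: (n) => [|n'] ; [by rewrite mul0n|rewrite mulnDr; lia].
have obs i : observable (ctrlE A C Lf) (K i).
  have := obsEK i 0; rewrite (_ : row 0 (K i) = K i)//.
  by apply/rowP => j; rewrite mxE.
have free i := ae_row_free_dataH (run i) posV (obs i) ctrlEL (nconf i) rank_le.
apply: ae_imply (ae_forall_countable free) => om {}free.
have gainE i : dataU n (T - n + 1) (fun s => u i s om) t *m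
    mpinv (dataH n (T - n + 1) (fun s => u i s om) (fun s => y i s om) t) =
    row_mx (K i) 1%:M *m Lest (ctrlE A C Lf) (ctrlF B C Lf) Lf a.
  apply: dataU_mpinv (free i) => s.
  apply: (Lest_predict (z := fun s => xh i s om) _ ha) => s'.
    exact: run_xh (run i) s' om.
  exact: run_u (run i) s' om.
apply/seteqP; split=> z; rewrite /Ker /=.
  by move=> Lz i _; rewrite /= gainE -mulmxA Lz mulmx0.
move=> Kz; suff : (\bigcap_(i in [set: 'I_N]) Ker (row_mx (K i) 1%:M))
    (Lest (ctrlE A C Lf) (ctrlF B C Lf) Lf a *m z) by rewrite kerK.
by move=> i _; have := Kz i I; rewrite /= gainE /Ker /= mulmxA.
Qed.
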